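(* Let $E = c_0$ carry the truncation $\tau_E(f) = f \wedge \mathbf{1}$ (pointwise meet with the constant sequence $\mathbf 1$), and let $F = c_0/c_{00}$ carry the identity truncation $\tau_F(g) = g$ $(g \in F^{+})$. Let $\pi : c_0 \to c_0/c_{00}$ be the quotient map. Then $T = -\pi : c_0 \to c_0/c_{00}$ is a surjective truncation homomorphism which is not a Riesz homomorphism, and is not even a positive operator. In particular, it is not true that every truncation homomorphism from a Riesz space with an Archimedean truncation into a Riesz space with an arbitrary truncation is a Riesz homomorphism.
   Context: All Riesz spaces are real. A truncation on a Riesz space $E$ is a map $\tau : E^{+} \to E^{+}$ such that $\tau(f) \wedge g = f \wedge \tau(g)$ for all $f, g \in E^{+}$. It is Archimedean if, for $f \in E^{+}$, $\tau(nf) = nf$ for all $n \in \mathbb{N}$ implies $f = 0$. The associated extended truncation is the map $\widetilde{\tau} : E \to E$, $\widetilde{\tau}(f) = \tau(f^{+}) - f^{-}$. Given Riesz spaces with truncations $(E,\tau_E)$ and $(F,\tau_F)$, a linear operator $T : E \to F$ is a truncation homomorphism if $T \circ \widetilde{\tau_E} = \widetilde{\tau_F} \circ T$. Here $c_0$ is the Riesz space of real null sequences, $c_{00}$ its ideal of finitely supported sequences, and $c_0/c_{00}$ is the quotient Riesz space. *)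

(* Defs.v *)
From HB Require Import structures.
From mathcomp Require Import all_boot all_order all_algebra.
From mathcomp Require Import all_classical all_reals all_analysis.

Set Implicit Arguments.
Unset Strict Implicit.
Unset Printing Implicit Defensive.

Import Order.TTheory GRing.Theory Num.Theory numFieldNormedType.Exports.

Local Open Scope classical_set_scope.
Local Open Scope ring_scope.

(* A Riesz space is a real vector space with a compatible lattice order.  The
   lattice operations are fields of the mixin because the hierarchy has no join
   of Order.Lattice and GRing.Lmodule below Num.RealDomain; every Riesz space is
   then made a latticeType, so that the meet and join of E are the library's. *)
HB.mixin Record isRiesz (R : realType) V
    of GRing.Lmodule R V & Order.POrder ring_display V := {
  riesz_meet : V -> V -> V;
  riesz_join : V -> V -> V;
  riesz_meetP : forall x y z : V, (x <= riesz_meet y z) = (x <= y) && (x <= z);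
  riesz_joinP : forall x y z : V, (riesz_join x y <= z) = (x <= z) && (y <= z);
  riesz_leD2r : forall z x y : V, x <= y -> x + z <= y + z;
  riesz_scale_ge0 : forall (a : R) (x : V), 0 <= a -> 0 <= x -> 0 <= a *: x
}.

#[short(type="rieszType")]
HB.structure Definition Riesz (R : realType) :=
  {V of GRing.Lmodule R V & Order.POrder ring_display V & isRiesz R V}.

Arguments riesz_leD2r {R s} z [x y].
Arguments riesz_scale_ge0 {R s} [a x].

HB.instance Definition _ (R : realType) (E : rieszType R) :=
  Order.POrder_MeetJoin_isLattice.Build ring_display (Riesz.sort E)
    riesz_meetP riesz_joinP.

Section RieszTheory.
Variables (R : realType) (E : rieszType R).
Implicit Types x y z : E.

Definition riesz_pos x : E := (x `|` 0)%O.
Definition riesz_neg x : E := ((- x) `|` 0)%O.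
Definition riesz_abs x : E := (x `|` (- x))%O.

Lemma riesz_pos_ge0 x : 0 <= riesz_pos x.
Proof. exact: leUr. Qed.

Lemma riesz_leD x y z t : x <= y -> z <= t -> x + z <= y + t.
Proof.
move=> xy zt; apply: (le_trans (riesz_leD2r z xy)).
by rewrite !(addrC y); exact: riesz_leD2r.
Qed.

Lemma riesz_leDl z x y : (x + z <= y + z) = (x <= y).
Proof.
apply/idP/idP => [/(riesz_leD2r (- z))|]; last exact: riesz_leD2r.
by rewrite !addrK.
Qed.

Lemma riesz_le_subl x y z : (x - y <= z) = (x <= z + y).
Proof. by rewrite -[LHS](riesz_leDl y) subrK. Qed.

Lemma riesz_abs_ge x : x <= riesz_abs x.
Proof. exact: leUl. Qed.

Lemma riesz_abs_geN x : - x <= riesz_abs x.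
Proof. exact: leUr. Qed.

Lemma riesz_abs_ge0 x : 0 <= riesz_abs x.
Proof.
have : 0 <= riesz_abs x + riesz_abs x.
  rewrite -(subrr x); apply: riesz_leD; first exact: riesz_abs_ge.
  exact: riesz_abs_geN.
have h : (0 : R) <= 2^-1 by rewrite invr_ge0.
move=> /(riesz_scale_ge0 h).
by rewrite -mulr2n -[riesz_abs x *+ 2]scaler_nat scalerA mulVf ?scale1r// pnatr_eq0.
Qed.

Lemma riesz_abs_id x : 0 <= x -> riesz_abs x = x.
Proof.
move=> x0; apply/join_l; apply: le_trans (x0).
by have := riesz_leD2r (- x) x0; rewrite add0r subrr.
Qed.

Lemma riesz_le_absDl x y : x <= riesz_abs x + riesz_abs y.
Proof.
by rewrite -[leLHS]addr0 riesz_leD ?riesz_abs_ge ?riesz_abs_ge0.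
Qed.

Lemma riesz_le_absDr x y : y <= riesz_abs x + riesz_abs y.
Proof. by rewrite addrC riesz_le_absDl. Qed.

Lemma riesz_absD_ge0 x y : 0 <= riesz_abs x + riesz_abs y.
Proof. by rewrite -[leLHS]addr0 riesz_leD ?riesz_abs_ge0. Qed.

End RieszTheory.

(* Order ideals: solid vector subspaces. *)
Record rieszIdeal (R : realType) (E : rieszType R) := RieszIdeal {
  ideal_pred :> {pred E};
  ideal_submod : GRing.submod_closed ideal_pred;
  ideal_solid : forall f g : E,
    f \in ideal_pred -> riesz_abs g <= riesz_abs f -> g \in ideal_pred
}.

HB.instance Definition _ (R : realType) (E : rieszType R) (I : rieszIdeal E) :=
  GRing.isSubmodClosed.Build R E (ideal_pred I) (ideal_submod I).

Definition ideal_zmod (R : realType) (E : rieszType R) (I : rieszIdeal E) :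
  zmodClosed E := GRing.ZmodClosed.clone E (ideal_pred I) _.

Definition riesz_quot (R : realType) (E : rieszType R) (I : rieszIdeal E) :=
  {ideal_quot (ideal_zmod I)}.

HB.instance Definition _ (R : realType) (E : rieszType R) (I : rieszIdeal E) :=
  GRing.Zmodule.on (riesz_quot I).

Section RieszQuotient.
Local Open Scope quotient_scope.
Variables (R : realType) (E : rieszType R) (I : rieszIdeal E).
Local Notation Q := (riesz_quot I).
Implicit Types (f g h : E) (x y z : Q).

Definition riesz_pi f : Q := \pi_({ideal_quot (ideal_zmod I)}) f.

Definition riesz_repr x : E := repr (x : {ideal_quot (ideal_zmod I)}).

Lemma riesz_reprK : cancel riesz_repr riesz_pi.
Proof. by move=> x; rewrite /riesz_pi/riesz_repr reprK. Qed.

Lemma riesz_piP f g : riesz_pi f = riesz_pi g <-> f - g \in I.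
Proof. by rewrite /riesz_pi Quotient.idealrBE; split=> /eqP. Qed.

Lemma riesz_piB : zmod_morphism riesz_pi.
Proof. by move=> f g; rewrite /riesz_pi raddfB. Qed.

HB.instance Definition _ := GRing.isZmodMorphism.Build E Q riesz_pi riesz_piB.

Definition riesz_quot_scale (a : R) x : Q := riesz_pi (a *: riesz_repr x).

Lemma riesz_pi_scale a f : riesz_quot_scale a (riesz_pi f) = riesz_pi (a *: f).
Proof.
apply/riesz_piP; rewrite -scalerBr rpredZ//.
by apply/riesz_piP; rewrite riesz_reprK.
Qed.

Fact riesz_quot_scaleA a b x :
  riesz_quot_scale a (riesz_quot_scale b x) = riesz_quot_scale (a * b) x.
Proof. by rewrite -[x]riesz_reprK !riesz_pi_scale scalerA. Qed.

Fact riesz_quot_scale1 : left_id 1 riesz_quot_scale.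
Proof. by move=> x; rewrite -[x]riesz_reprK riesz_pi_scale scale1r. Qed.

Fact riesz_quot_scaleDr : right_distributive riesz_quot_scale +%R.
Proof.
move=> a x y; rewrite -[x]riesz_reprK -[y]riesz_reprK -raddfD !riesz_pi_scale.
by rewrite scalerDr raddfD.
Qed.

Fact riesz_quot_scaleDl x : {morph riesz_quot_scale^~ x : a b / a + b}.
Proof.
by move=> a b; rewrite -[x]riesz_reprK !riesz_pi_scale scalerDl raddfD.
Qed.

HB.instance Definition _ := GRing.Zmodule_isLmodule.Build R Q
  riesz_quot_scaleA riesz_quot_scale1 riesz_quot_scaleDr riesz_quot_scaleDl.

Fact riesz_piZ : scalable riesz_pi.
Proof. by move=> a f; rewrite -riesz_pi_scale. Qed.

HB.instance Definition _ := GRing.isScalable.Build R E Q *:%R riesz_pi riesz_piZ.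

(* [f] <= [g] when some representatives f' of [f] and g' of [g] satisfy
   f' <= g'; the meet and join below make the projection a lattice morphism
   (riesz_pi_meet, riesz_pi_join). *)
Definition riesz_quot_le x y : bool :=
  `[< exists f g, [/\ riesz_pi f = x, riesz_pi g = y & f <= g] >].

Lemma riesz_quot_leP f g :
  reflect (exists2 h, h \in I & f <= g + h)
          (riesz_quot_le (riesz_pi f) (riesz_pi g)).
Proof.
apply: (iffP (asboolP _)) => [[f' [g' [/riesz_piP ff /riesz_piP gg fg]]]|].
  exists ((g' - g) - (f' - f)); first exact: rpredB.
  by rewrite addrA [g + _]addrC subrK -(riesz_leDl (f' - f)) subrK addrC subrK.
move=> [h hI fgh]; exists f, (g + h); split=> //.
by apply/riesz_piP; rewrite addrAC subrr add0r.
Qed.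

Lemma riesz_abs_in f : f \in I -> riesz_abs f \in I.
Proof.
move=> fI; apply: (ideal_solid (f := f)) => //.
by rewrite (riesz_abs_id (riesz_abs_ge0 f)).
Qed.

Fact riesz_quot_le_refl : reflexive riesz_quot_le.
Proof.
move=> x; apply/asboolP.
by exists (riesz_repr x), (riesz_repr x); rewrite riesz_reprK.
Qed.

Fact riesz_quot_le_anti : antisymmetric riesz_quot_le.
Proof.
move=> x y; rewrite -[x]riesz_reprK -[y]riesz_reprK.
set f := riesz_repr x; set g := riesz_repr y.
move=> /andP[/riesz_quot_leP[h hI fg] /riesz_quot_leP[k kI gf]].
apply/riesz_piP; apply: (ideal_solid (f := riesz_abs h + riesz_abs k)).
  by rewrite rpredD// riesz_abs_in.
rewrite (riesz_abs_id (x := riesz_abs h + riesz_abs k)); last first.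
  exact: riesz_absD_ge0.
rewrite leUx; apply/andP; split.
  by rewrite riesz_le_subl (le_trans fg)// addrC riesz_leDl riesz_le_absDl.
by rewrite opprB riesz_le_subl (le_trans gf)// addrC riesz_leDl riesz_le_absDr.
Qed.

Fact riesz_quot_le_trans : transitive riesz_quot_le.
Proof.
move=> y x z; rewrite -[x]riesz_reprK -[y]riesz_reprK -[z]riesz_reprK.
move=> /riesz_quot_leP[h hI xy] /riesz_quot_leP[k kI yz].
apply/riesz_quot_leP; exists (k + h); first exact: rpredD.
by rewrite addrA (le_trans xy)// riesz_leDl.
Qed.

HB.instance Definition _ := Order.Le_isPOrder.Build ring_display Q
  riesz_quot_le_refl riesz_quot_le_anti riesz_quot_le_trans.

Lemma riesz_pi_leP f g :
  reflect (exists2 h, h \in I & f <= g + h) (riesz_pi f <= riesz_pi g).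
Proof. exact: riesz_quot_leP. Qed.

Lemma riesz_pi_le f g : f <= g -> riesz_pi f <= riesz_pi g.
Proof. by move=> fg; apply/riesz_pi_leP; exists 0; rewrite ?rpred0 ?addr0. Qed.

Definition riesz_quot_meet x y : Q :=
  riesz_pi (riesz_repr x `&` riesz_repr y)%O.

Definition riesz_quot_join x y : Q :=
  riesz_pi (riesz_repr x `|` riesz_repr y)%O.

Lemma riesz_le_pi_meet f g h :
  (riesz_pi h <= riesz_pi (f `&` g)%O)
  = (riesz_pi h <= riesz_pi f) && (riesz_pi h <= riesz_pi g).
Proof.
apply/idP/andP => [hfg|[/riesz_pi_leP[k kI hf] /riesz_pi_leP[l lI hg]]].
  by split; apply: le_trans hfg _; apply: riesz_pi_le; [exact: leIl|exact: leIr].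
apply/riesz_pi_leP; exists (riesz_abs k + riesz_abs l).
  by rewrite rpredD// riesz_abs_in.
rewrite -riesz_le_subl lexI !riesz_le_subl; apply/andP; split.
  by rewrite (le_trans hf)// ![f + _]addrC riesz_leDl riesz_le_absDl.
by rewrite (le_trans hg)// ![g + _]addrC riesz_leDl riesz_le_absDr.
Qed.

Lemma riesz_pi_join_le f g h :
  (riesz_pi (f `|` g)%O <= riesz_pi h)
  = (riesz_pi f <= riesz_pi h) && (riesz_pi g <= riesz_pi h).
Proof.
apply/idP/andP => [fgh|[/riesz_pi_leP[k kI fh] /riesz_pi_leP[l lI gh]]].
  by split; apply: le_trans fgh; apply: riesz_pi_le; [exact: leUl|exact: leUr].
apply/riesz_pi_leP; exists (riesz_abs k + riesz_abs l).
  by rewrite rpredD// riesz_abs_in.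
rewrite leUx; apply/andP; split.
  by rewrite (le_trans fh)// ![h + _]addrC riesz_leDl riesz_le_absDl.
by rewrite (le_trans gh)// ![h + _]addrC riesz_leDl riesz_le_absDr.
Qed.

Fact riesz_quot_meetP x y z :
  (x <= riesz_quot_meet y z) = (x <= y) && (x <= z).
Proof.
by rewrite -[x in LHS]riesz_reprK riesz_le_pi_meet !riesz_reprK.
Qed.

Fact riesz_quot_joinP x y z :
  (riesz_quot_join x y <= z) = (x <= z) && (y <= z).
Proof.
by rewrite -[z in LHS]riesz_reprK riesz_pi_join_le !riesz_reprK.
Qed.

Fact riesz_quot_leD2r z x y : x <= y -> x + z <= y + z.
Proof.
rewrite -[x]riesz_reprK -[y]riesz_reprK -[z]riesz_reprK -!raddfD.
move=> /riesz_pi_leP[h hI xy]; apply/riesz_pi_leP; exists h => //.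
by rewrite addrAC riesz_leDl.
Qed.

Fact riesz_quot_scale_ge0 (a : R) x : 0 <= a -> 0 <= x -> 0 <= a *: x.
Proof.
move=> a0; rewrite -[x]riesz_reprK -(raddf0 riesz_pi) -linearZ/=.
move=> /riesz_pi_leP[h hI xy]; apply/riesz_pi_leP; exists (a *: h).
  exact: rpredZ.
by rewrite -scalerDr riesz_scale_ge0.
Qed.

HB.instance Definition _ := isRiesz.Build R Q
  riesz_quot_meetP riesz_quot_joinP riesz_quot_leD2r riesz_quot_scale_ge0.

HB.instance Definition _ := Order.Lattice.copy Q (Riesz.sort (Q : rieszType R)).

Lemma riesz_pi_surj x : exists f, riesz_pi f = x.
Proof. by exists (riesz_repr x); exact: riesz_reprK. Qed.

Lemma riesz_pi_join : {morph riesz_pi : f g / (f `|` g)%O}.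
Proof.
move=> f g; apply: le_anti; apply/andP; split.
  by rewrite -[leRHS]riesz_reprK riesz_pi_join_le riesz_reprK leUl leUr.
by rewrite leUx; apply/andP; split; apply: riesz_pi_le; rewrite ?leUl ?leUr.
Qed.

Lemma riesz_pi_meet : {morph riesz_pi : f g / (f `&` g)%O}.
Proof.
move=> f g; apply: le_anti; apply/andP; split.
  by rewrite lexI; apply/andP; split; apply: riesz_pi_le; rewrite ?leIl ?leIr.
by rewrite -[leLHS]riesz_reprK riesz_le_pi_meet riesz_reprK leIl leIr.
Qed.

End RieszQuotient.

Section Truncation.
Variables (R : realType).

Definition posCone (E : rieszType R) := {x : E | 0 <= x}.

Definition pos_part (E : rieszType R) (x : E) : posCone E :=
  exist _ (riesz_pos x) (riesz_pos_ge0 x).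

Definition is_truncation (E : rieszType R) (tau : posCone E -> posCone E) :=
  forall f g : posCone E, (val (tau f) `&` val g = val f `&` val (tau g))%O.

Lemma posCone_mulrn_ge0 (E : rieszType R) (f : posCone E) n : 0 <= val f *+ n.
Proof.
by rewrite -scaler_nat riesz_scale_ge0 ?ler0n//; exact: (valP f).
Qed.

Definition posCone_mulrn (E : rieszType R) (f : posCone E) n : posCone E :=
  exist _ (val f *+ n) (posCone_mulrn_ge0 f n).

Definition archimedean_truncation (E : rieszType R)
    (tau : posCone E -> posCone E) :=
  forall f : posCone E,
    (forall n, tau (posCone_mulrn f n) = posCone_mulrn f n) -> val f = 0.

Definition extended_truncation (E : rieszType R)
    (tau : posCone E -> posCone E) (f : E) : E :=
  val (tau (pos_part f)) - riesz_neg f.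

Definition truncation_hom (E F : rieszType R)
    (tauE : posCone E -> posCone E) (tauF : posCone F -> posCone F)
    (T : {linear E -> F}) :=
  T \o extended_truncation tauE =1 extended_truncation tauF \o T.

Definition riesz_hom (E F : rieszType R) (T : {linear E -> F}) :=
  {morph T : f g / (f `|` g)%O} /\ {morph T : f g / (f `&` g)%O}.

Definition positive_operator (E F : rieszType R) (T : {linear E -> F}) :=
  forall f : E, 0 <= f -> 0 <= T f.

End Truncation.

Section c0.
Variable R : realType.

Definition null_seq : {pred nat -> R} := fun u => `[< u @ \oo --> (0 : R) >].

Record c0 := C0 { c0_val :> nat -> R; c0P : c0_val \in null_seq }.

HB.instance Definition _ := [isSub for c0_val].
HB.instance Definition _ := [Choice of c0 by <:].

Fact null_seq_submod : GRing.submod_closed null_seq.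
Proof.
split=> [|a u v /asboolP u0 /asboolP v0]; apply/asboolP; first exact: cvg_cst.
rewrite (_ : 0 = a * 0 + 0 :> R); last by rewrite mulr0 addr0.
apply: cvgD; last exact: v0.
by exact: cvgZl_tmp.
Qed.

HB.instance Definition _ :=
  GRing.isSubmodClosed.Build R (nat -> R) null_seq null_seq_submod.
HB.instance Definition _ := [SubChoice_isSubLmodule of c0 by <:].
HB.instance Definition _ :=
  Order.SubChoice_isSubPOrder.Build _ _ _ ring_display c0.

Lemma c0_leP (f g : c0) : reflect (forall n, f n <= g n) (f <= g).
Proof. exact: lefP. Qed.

Fact null_seq_max (u v : nat -> R) : u \in null_seq -> v \in null_seq ->
  (fun n => Num.max (u n) (v n)) \in null_seq.
Proof.
move=> /asboolP u0 /asboolP v0; apply/asboolP.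
have -> : (fun n => Num.max (u n) (v n)) =
    fun n => (u n + v n + `|u n - v n|) / 2.
  by apply/funext => n; exact: maxr_absE.
have <- : (0 + 0 + `|0 - 0 : R|) / 2 = 0 :> R.
  by rewrite !subrr normr0 ?subr0 !addr0 mul0r.
apply: cvgMr_tmp.
apply: cvgD; first exact: cvgD.
by apply: cvg_norm; exact: cvgB.
Qed.

Fact null_seq_min (u v : nat -> R) : u \in null_seq -> v \in null_seq ->
  (fun n => Num.min (u n) (v n)) \in null_seq.
Proof.
move=> /asboolP u0 /asboolP v0; apply/asboolP.
have -> : (fun n => Num.min (u n) (v n)) =
    fun n => (u n + v n - `|u n - v n|) / 2.
  by apply/funext => n; exact: minr_absE.
have <- : (0 + 0 - `|0 - 0 : R|) / 2 = 0 :> R.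
  by rewrite !subrr normr0 ?subr0 !addr0 mul0r.
apply: cvgMr_tmp.
apply: cvgB; first exact: cvgD.
by apply: cvg_norm; exact: cvgB.
Qed.

Definition c0_join (f g : c0) : c0 := C0 (null_seq_max (c0P f) (c0P g)).

Definition c0_meet (f g : c0) : c0 := C0 (null_seq_min (c0P f) (c0P g)).

Fact c0_meetP (f g h : c0) : (f <= c0_meet g h) = (f <= g) && (f <= h).
Proof.
apply/c0_leP/andP => [fgh|[/c0_leP fg /c0_leP fh] n]; last first.
  by rewrite /= le_min fg fh.
by split; apply/c0_leP => n; move: (fgh n); rewrite /= le_min => /andP[].
Qed.

Fact c0_joinP (f g h : c0) : (c0_join f g <= h) = (f <= h) && (g <= h).
Proof.
apply/c0_leP/andP => [fgh|[/c0_leP fh /c0_leP gh] n]; last first.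
  by rewrite /= ge_max fh gh.
by split; apply/c0_leP => n; move: (fgh n); rewrite /= ge_max => /andP[].
Qed.

Fact c0_leD2r (h f g : c0) : f <= g -> f + h <= g + h.
Proof. by move=> /c0_leP fg; apply/c0_leP => n; apply: lerD. Qed.

Fact c0_scale_ge0 (a : R) (f : c0) : 0 <= a -> 0 <= f -> 0 <= a *: f.
Proof.
by move=> a0 /c0_leP f0; apply/c0_leP => n; apply: mulr_ge0 => //; exact: f0.
Qed.

HB.instance Definition _ := isRiesz.Build R c0
  c0_meetP c0_joinP c0_leD2r c0_scale_ge0.
HB.instance Definition _ :=
  Order.Lattice.copy c0 (Riesz.sort (c0 : rieszType R)).

Lemma c0_joinE (f g : c0) n : (f `|` g)%O n = Num.max (f n) (g n).
Proof. by []. Qed.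

Lemma c0_meetE (f g : c0) n : (f `&` g)%O n = Num.min (f n) (g n).
Proof. by []. Qed.

Definition finitely_supported : {pred c0} :=
  fun f => `[< finite_set [set n | f n != 0] >].

Fact finitely_supported_submod : GRing.submod_closed finitely_supported.
Proof.
split=> [|a f g /asboolP fin_f /asboolP fin_g]; apply/asboolP.
  by rewrite (_ : [set n | _] = set0)// -subset0 => n /=; rewrite eqxx.
apply: (@sub_finite_set _ _ ([set n | f n != 0] `|` [set n | g n != 0])).
  move=> n /=; apply: contraNP => /not_orP[/negP fn0 /negP gn0].
  move: fn0 gn0; rewrite !negbK => /eqP fn0 /eqP gn0.
  by apply/eqP; rewrite [LHS](_ : _ = a * f n + g n)// fn0 gn0 mulr0 addr0.
by rewrite finite_setU.
Qed.

Lemma c0_absE (f : c0) n : (riesz_abs f : c0) n = `|f n|.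
Proof. by rewrite -[RHS]maxrN. Qed.

Fact finitely_supported_solid (f g : c0) : f \in finitely_supported ->
  (riesz_abs g : c0) <= riesz_abs f -> g \in finitely_supported.
Proof.
move=> /asboolP fin_f /c0_leP gf; apply/asboolP.
apply: sub_finite_set fin_f => n /=; apply: contra_neq => fn0; apply/eqP.
by have := gf n; rewrite !c0_absE fn0 normr0 normr_le0.
Qed.

Definition c00 : rieszIdeal (c0 : rieszType R) :=
  RieszIdeal finitely_supported_submod finitely_supported_solid.

Fact null_seq_min1 (u : nat -> R) : u \in null_seq ->
  (fun n => Num.min (u n) 1) \in null_seq.
Proof.
move=> /asboolP u0; apply/asboolP; apply: cvg_trans (u0); apply: near_eq_cvg.
near=> n; apply/esym/min_l; rewrite (le_trans (ler_norm _))//; apply/ltW.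
by near: n; apply: (cvgr0_norm_lt _ u0); exact: ltr01.
Unshelve. all: by end_near. Qed.

Fact c0_min1_ge0 (f : posCone c0) :
  0 <= (C0 (null_seq_min1 (c0P (val f))) : (c0 : rieszType R)).
Proof.
apply/c0_leP => n; have /c0_leP/(_ n) f0 := valP f.
by rewrite le_min f0 ler01.
Qed.

(* The constant sequence 1 is not in c0, so f `&` 1 is a meet of sequences and
   not a meet of the lattice c0. *)
Definition c0_truncation (f : posCone c0) : posCone c0 :=
  exist _ (C0 (null_seq_min1 (c0P (val f)))) (c0_min1_ge0 f).

End c0.

(* Main.v *)
Require Import Defs.
From mathcomp Require Import all_boot all_order all_algebra.
From mathcomp Require Import all_classical all_reals all_analysis.

(** The truncation [f `&` 1] on null sequences is invisible modulo [c00]: a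
    null sequence is eventually below 1, so truncating changes only finitely
    many terms ([c0_sub_truncation_c00]), and [riesz_pi] sends both [f] and its
    extended truncation to the same class ([riesz_pi_extended_truncation]).
    On the quotient, the extended truncation of the identity is the identity,
    because [x = riesz_pos x - riesz_neg x].  Hence every scalar multiple of
    the projection is a truncation homomorphism, and the multiple by -1 reverses
    the order: it would be positive only if every nonnegative null sequence were
    dominated by a finitely supported one, which the harmonic sequence refutes
    ([riesz_pi_harmonic_nle0]).  A Riesz homomorphism is positive, so the
    opposite of the projection is not one.  The truncation on [c0] is
    Archimedean because the reals are, so this same map refutes the general
    claim. *)

Set Implicit Arguments.
Unset Strict Implicit.
Unset Printing Implicit Defensive.

Import Order.TTheory GRing.Theory Num.Theory numFieldNormedType.Exports.

Local Open Scope ring_scope.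

Lemma riesz_joinDr (R : realType) (E : rieszType R) (x y z : E) :
  (x `|` y)%O + z = ((x + z) `|` (y + z))%O.
Proof.
apply: le_anti; apply/andP; split.
  rewrite -[z in leLHS]opprK riesz_le_subl leUx.
  by rewrite -!riesz_le_subl opprK leUl leUr.
by rewrite leUx !riesz_leDl leUl leUr.
Qed.

Lemma riesz_posBneg (R : realType) (E : rieszType R) (x : E) :
  riesz_pos x - riesz_neg x = x.
Proof.
apply/eqP; rewrite subr_eq addrC; apply/eqP.
by rewrite /riesz_neg riesz_joinDr addNr add0r joinC.
Qed.

Lemma is_truncation_id (R : realType) (E : rieszType R) :
  is_truncation (id : posCone E -> posCone E).
Proof. by []. Qed.

Lemma extended_truncation_id (R : realType) (E : rieszType R) :
  extended_truncation (id : posCone E -> posCone E) =1 id.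
Proof. exact: riesz_posBneg. Qed.

Lemma riesz_hom_positive (R : realType) (E F : rieszType R)
    (T : {linear E -> F}) : riesz_hom T -> positive_operator T.
Proof.
move=> [Tjoin _] f f0.
by have := Tjoin f 0; rewrite (join_l f0) linear0 => ->; exact: leUr.
Qed.

Section NullSequences.
Variable R : realType.

Lemma c0_val_inj : injective (@c0_val R).
Proof. exact: val_inj. Qed.

Lemma c0_truncation_is_truncation : is_truncation (@c0_truncation R).
Proof.
move=> f g; apply: c0_val_inj; apply/funext => n.
by rewrite !c0_meetE /= -minA [Num.min 1 _]minC.
Qed.

Lemma c0_mulrnE (f : c0 R) k n : (f *+ k) n = f n *+ k.
Proof. by elim: k => // k IH; rewrite !mulrS -IH. Qed.

(** If every multiple of [f] is fixed then all multiples of each term of [f]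
    are at most 1. *)
Lemma c0_truncation_archimedean : archimedean_truncation (@c0_truncation R).
Proof.
move=> f fixf; apply: c0_val_inj; apply/funext => n.
have /c0_leP/(_ n) f0 := valP f.
apply/eqP; rewrite eq_le [X in _ && X]f0 andbT leNgt; apply/negP => fn0.
have [k] : exists k, 1 < (val f n) *+ k.
  exists (Num.truncn (val f n)^-1).+1.
  rewrite -mulr_natl -ltr_pdivrMr// div1r.
  exact: truncnS_gt.
have /= := congr1 (fun g : posCone (c0 R) => c0_val (val g) n) (fixf k).
by rewrite c0_mulrnE => <-; rewrite lt_min ltxx andbF.
Qed.

Lemma c0_sub_truncation_c00 (f : posCone (c0 R : rieszType R)) :
  val (c0_truncation f) - val f \in c00 R.
Proof.
apply/asboolP.
have /asboolP f0 := c0P (val f).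
have [N _ fN] := cvgr0_norm_lt _ f0 _ (@ltr01 R).
apply: (@sub_finite_set _ _ `I_N); last exact: finite_II.
move=> n /= hn; rewrite ltnNge; apply/negP => /fN /= fn1.
move/eqP: hn; apply; apply/eqP; rewrite subr_eq0; apply/eqP/min_l.
exact: (le_trans (ler_norm _) (ltW fn1)).
Qed.

Lemma riesz_pi_extended_truncation (f : c0 R : rieszType R) :
  riesz_pi (c00 R) (extended_truncation (@c0_truncation R) f) =
  riesz_pi (c00 R) f.
Proof.
apply/riesz_piP; rewrite -[f in X in _ - X]riesz_posBneg.
by rewrite /extended_truncation opprB addrA subrK c0_sub_truncation_c00.
Qed.

Fact harmonic_null_seq : @harmonic R \in @null_seq R.
Proof. by apply/asboolP; exact: cvg_harmonic. Qed.

Definition c0_harmonic : c0 R := C0 harmonic_null_seq.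

Lemma c0_harmonic_ge0 : 0 <= c0_harmonic.
Proof. by apply/c0_leP => n; exact: harmonic_ge0. Qed.

(** A sequence of [c00] dominating the harmonic one would have every natural
    number in its support. *)
Lemma riesz_pi_harmonic_nle0 : ~ riesz_pi (c00 R) c0_harmonic <= 0.
Proof.
rewrite -(raddf0 (riesz_pi (c00 R))) => /riesz_pi_leP[h /asboolP fin_h].
rewrite add0r => /c0_leP harm_h; apply: infinite_nat.
apply: sub_finite_set fin_h => n _ /=.
by rewrite gt_eqF// (lt_le_trans _ (harm_h n)) ?harmonic_gt0.
Qed.

End NullSequences.

Theorem theorem3p13 (R : realType) :
  let E : rieszType R := c0 R in
  let F : rieszType R := riesz_quot (c00 R) in
  let tauE : posCone E -> posCone E := @c0_truncation R in
  let tauF : posCone F -> posCone F := id in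
  let T : {linear E -> F} := \- @riesz_pi R E (c00 R) in
  [/\ is_truncation tauE, archimedean_truncation tauE & is_truncation tauF] /\
  [/\ (forall y : F, exists x : E, T x = y),
      truncation_hom tauE tauF T,
      ~ riesz_hom T
    & ~ positive_operator T] /\
  ~ (forall (E' F' : rieszType R) (tauE' : posCone E' -> posCone E')
        (tauF' : posCone F' -> posCone F') (T' : {linear E' -> F'}),
      is_truncation tauE' -> archimedean_truncation tauE' ->
      is_truncation tauF' -> truncation_hom tauE' tauF' T' ->
      riesz_hom T').
Proof.
move=> E F tauE tauF T.
have truncE : is_truncation tauE by exact: c0_truncation_is_truncation.
have archE : archimedean_truncation tauE by exact: c0_truncation_archimedean.
have truncF : is_truncation tauF by exact: is_truncation_id.
have Thom : truncation_hom tauE tauF T.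
  move=> f /=; rewrite extended_truncation_id.
  by congr (- _); exact: riesz_pi_extended_truncation.
have Tnpos : ~ positive_operator T.
  move=> /(_ _ (c0_harmonic_ge0 R)) T0; apply: (@riesz_pi_harmonic_nle0 R).
  have := riesz_leD2r (riesz_pi (c00 R) (c0_harmonic R)) T0.
  by rewrite add0r /= addNr.
have Tnriesz : ~ riesz_hom T by move=> /riesz_hom_positive.
do 2!split=> //; last first.
  by move=> /(_ E F tauE tauF T truncE archE truncF Thom).
split=> // y; have [x xy] := riesz_pi_surj (- y).
by exists x; rewrite /= xy opprK.
Qed.
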